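(* Assume the standing setting described in the context, with $\nu>0$ (i.e. $g$ is $\nu$-strongly convex), and assume in addition that there is $\mu>0$ such that for all $y\in\operatorname{dom} g$ the function $\Phi(\cdot,y):\mathcal{H}\to\mathbb{R}\cup\{+\infty\}$ is $\mu$-strongly convex. Let $(x^{\ast},y^{\ast})\in\mathcal{H}\times\mathcal{G}$ be a saddle point of $\min_{x\in\mathcal{H}}\max_{y\in\mathcal{G}}\Psi(x,y)$. Let $\alpha>0$, $$\tilde{\theta} = \max \left\{ \frac{L_{yx}}{\alpha \mu + L_{yx}},\ \frac{\alpha L_{yx} + 2 L_{yy}}{\nu + \alpha L_{yx} + 2L_{yy}} \right\},$$ and let $$0\le\tilde\theta<\theta<1,\qquad \tau = \frac{1}{\mu} \frac{1 - \theta}{\theta},\qquad \sigma = \frac{1}{\nu} \frac{1 - \theta}{\theta}.$$ Let $(x_k,y_k)_{k\ge0}$ be the sequence generated by the algorithm OGAProx with the constant parameters $\tau_k=\tau$, $\sigma_k=\sigma$, $\theta_k=\theta$ for all $k\ge0$. For $K\ge1$ denote $$T_{K} = \sum_{k=0}^{K-1} \theta^{-k},\qquad \bar{x}_{K} = \frac{1}{T_{K}} \sum_{k=0}^{K-1} \theta^{-k} x_{k+1},\qquad \bar{y}_{K} = \frac{1}{T_{K}} \sum_{k=0}^{K-1} \theta^{-k} y_{k+1}.$$ Then for all $K\ge1$ $$0 \leq \theta \big( \Psi(\bar{x}_{K},y^{\ast}) - \Psi(x^{\ast},\bar{y}_{K}) \big) + \frac{1}{2 \tau} \|x^{\ast}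 - x_{K}\|^{2} + \frac{1}{2 \tilde{\sigma}} \|y^{\ast} - y_{K}\|^{2} \leq \theta^{K} \left( \frac{1}{2 \tau} \|x^{\ast} - x_{0}\|^{2} + \frac{1}{2 \sigma} \|y^{\ast} - y_{0}\|^{2} \right),$$ where $\tilde{\sigma} := \frac{\sigma}{1 - \theta \sigma (\alpha L_{yx} + L_{yy})}$.
   Context: Setting. $\mathcal{H},\mathcal{G}$ are real Hilbert spaces, $\Phi:\mathcal{H}\times\mathcal{G}\to\mathbb{R}\cup\{+\infty\}$ with $\operatorname{dom}\Phi := \{(x,y) : \Phi(x,y)<+\infty\}\neq\emptyset$, and $g:\mathcal{G}\to\mathbb{R}\cup\{+\infty\}$ with $\operatorname{dom} g := \{y : g(y)<+\infty\}$. Put $P := \Pr_{\mathcal{H}}(\operatorname{dom}\Phi) := \{u\in\mathcal{H} : \exists y\in\mathcal{G},\ (u,y)\in\operatorname{dom}\Phi\}$. Standing assumptions: (i) $g$ is proper, lower semicontinuous and convex with modulus $\nu\ge 0$, i.e. $g-\frac{\nu}{2}\|\cdot\|^2$ is convex; (ii) for all $y\in\operatorname{dom} g$, $\Phi(\cdot,y):\mathcal{H}\to\mathbb{R}\cup\{+\infty\}$ is proper, convex and lower semicontinuous; (iii) for all $x\in P$, $\operatorname{dom}\Phi(x,\cdot)=\mathcal{G}$ and $\Phi(x,\cdot):\mathcal{G}\to\mathbb{R}$ is concave and Fréchet differentiable, with gradient at $y$ denoted $\nabla_y\Phi(x,y)$; moreover $P$ is closed; (iv) $L_{yx},L_{yy}\ge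 0$ are constants such that for all $(x,y),(x',y')\in P\times\operatorname{dom} g$: $\|\nabla_y\Phi(x,y)-\nabla_y\Phi(x',y')\|\le L_{yx}\|x-x'\|+L_{yy}\|y-y'\|$. A function $f$ is $\mu$-strongly convex if $f-\frac{\mu}{2}\|\cdot\|^2$ is convex. The objective is $\Psi(x,y) := \Phi(x,y)-g(y)$ with the convention $+\infty-(+\infty):=+\infty$; thus $\Psi(x,y)=-\infty$ if $x\in P$, $y\notin\operatorname{dom} g$; $\Psi(x,y)=\Phi(x,y)-g(y)\in\mathbb{R}$ if $x\in P$, $y\in\operatorname{dom} g$; $\Psi(x,y)=+\infty$ if $x\notin P$. A saddle point is a point $(x^*,y^* )\in\mathcal{H}\times\mathcal{G}$ with $\Psi(x^*,y)\le\Psi(x^*,y^* )\le\Psi(x,y^* )$ for all $(x,y)\in\mathcal{H}\times\mathcal{G}$. It is assumed that a saddle point exists. For a proper, convex, lower semicontinuous $f$ on a real Hilbert space, $\operatorname{prox}_f(x):=\operatorname{argmin}_u\{f(u)+\frac12\|u-x\|^2\}$. Algorithm OGAProx. Given $x_0\in P$, $y_0\in\operatorname{dom} g$, with $x_{-1}:=x_0$, $y_{-1}:=y_0$, and parameters $\sigma_k,\tau_k>0$, $\theta_k\in(0,1]$, for all $k\ge 0$: $y_{k+1}:=\operatorname{prox}_{\sigma_k g}\big(y_k+\sigma_k[(1+\theta_k)\nabla_y\Phi(x_k,y_k)-\theta_k\nabla_y\Phi(x_{k-1},y_{k-1})]\big)$, $x_{k+1}:=\operatorname{prox}_{\tau_k\Phi(\cdot,y_{k+1})}(x_k)$.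 *)

(* Defs.v *)
From HB Require Import structures.
From mathcomp Require Import all_boot all_order all_algebra.
From mathcomp Require Import all_classical all_reals all_analysis.

Set Implicit Arguments.
Unset Strict Implicit.
Unset Printing Implicit Defensive.

Import Order.TTheory GRing.Theory Num.Theory.
Import numFieldNormedType.Exports.

Local Open Scope classical_set_scope.
Local Open Scope ring_scope.

(* Definiteness is not a field: it follows from sqr_norm_inner. *)
HB.mixin Record CompleteNormedModule_isHilbert (R : realType) H
    of CompleteNormedModule R H := {
  inner : H -> H -> R ;
  innerC : forall u v, inner u v = inner v u ;
  inner_linearl : forall (a : R) (u v w : H),
    inner (a *: u + v) w = a * inner u w + inner v w ;
  sqr_norm_inner : forall u, `|u| ^+ 2 = inner u u
}.

#[short(type="hilbertType")]
HB.structure Definition Hilbert (R : realType) :=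
  {H of CompleteNormedModule_isHilbert R H & CompleteNormedModule R H}.

(* Functions into R U {+oo} are functions f into \bar R with f != -oo
   everywhere. *)
Section ConvexAnalysis.
Context {R : realType} {H : hilbertType R}.
Implicit Types (f : H -> \bar R) (x p : H).

Definition edom f : set H := [set x | (f x < +oo)%E].

Definition eproper f : Prop := (forall x, (-oo < f x)%E) /\ edom f !=set0.

(* Only used for f avoiding -oo or avoiding +oo, so that the right-hand side
   never is an indeterminate sum; 0 * +oo = 0 in \bar R, which makes t = 0 and
   t = 1 harmless. *)
Definition econvex f : Prop := forall (x y : H) (t : R), 0 <= t <= 1 ->
  (f (t *: x + (1 - t) *: y)%R <= t%:E * f x + (1 - t)%:E * f y)%E.

Definition econcave f : Prop := econvex (fun x => - f x)%E.

Definition strongly_convex (mu : R) f : Prop :=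
  econvex (fun x => f x - (mu / 2 * `|x| ^+ 2)%:E)%E.

(* The differential is represented by v; by the Riesz theorem such a v exists,
   and is unique, whenever f is Frechet differentiable at x. *)
Definition is_gradient (f : H -> R^o) x (v : H) : Prop :=
  differentiable f x /\ forall h, 'd f x h = inner v h.

Definition argmin f : set H := [set p | forall u, (f p <= f u)%E].

(* The prox as the set of minimizers, which is a singleton for f proper,
   convex and lower semicontinuous: p \in prox f x reads p = prox_f(x). *)
Definition prox f x : set H :=
  argmin (fun u => f u + (2^-1 * `|u - x| ^+ 2)%:E)%E.

End ConvexAnalysis.

Section SaddlePointProblem.
Context {R : realType} {H G : hilbertType R}.
Variables (Phi : H -> G -> \bar R) (g : G -> \bar R).

Definition projdom : set H := [set u | exists y, (Phi u y < +oo)%E].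

(* The dual addition of \bar R is the one for which +oo - +oo = +oo. *)
Definition Psi (x : H) (y : G) : \bar R := (Phi x y - g y)%dE.

Definition saddle_point (xs : H) (ys : G) : Prop :=
  forall x y, (Psi xs y <= Psi xs ys)%E /\ (Psi xs ys <= Psi x ys)%E.

(* gradPhi x y stands for the gradient at y of Phi x; it is constrained for
   x \in projdom only. *)
Record standing_assumptions (gradPhi : H -> G -> G) (nu Lyx Lyy : R) : Prop := {
  Phi_gtNy : forall x y, (-oo < Phi x y)%E ;
  Phi_dom : projdom !=set0 ;
  g_proper : eproper g ;
  g_lsc : lower_semicontinuous g ;
  nu_ge0 : 0 <= nu ;
  g_convex : strongly_convex nu g ;
  Phi_proper : forall y, edom g y -> eproper (Phi ^~ y) ;
  Phi_convex : forall y, edom g y -> econvex (Phi ^~ y) ;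
  Phi_lsc : forall y, edom g y -> lower_semicontinuous (Phi ^~ y) ;
  Phi_fin : forall x, projdom x -> edom (Phi x) = setT ;
  Phi_concave : forall x, projdom x -> econcave (Phi x) ;
  Phi_grad : forall x y, projdom x ->
    is_gradient (fun z => fine (Phi x z)) y (gradPhi x y) ;
  projdom_closed : closed projdom ;
  Lyx_ge0 : 0 <= Lyx ;
  Lyy_ge0 : 0 <= Lyy ;
  grad_lipschitz : forall x x' y y',
    projdom x -> projdom x' -> edom g y -> edom g y' ->
    `|gradPhi x y - gradPhi x' y'| <= Lyx * `|x - x'| + Lyy * `|y - y'|
}.

(* x_{-1} = x_0 and y_{-1} = y_0 are encoded by 0.-1 = 0. *)
Record OGAProx (gradPhi : H -> G -> G) (sigma tau theta : nat -> R)
    (x : nat -> H) (y : nat -> G) : Prop := {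
  OGAProx_x0 : projdom (x 0%N) ;
  OGAProx_y0 : edom g (y 0%N) ;
  OGAProx_y : forall k,
    prox (fun v => (sigma k)%:E * g v)%E
      (y k + sigma k *: ((1 + theta k) *: gradPhi (x k) (y k)
                         - theta k *: gradPhi (x k.-1) (y k.-1)))
      (y k.+1) ;
  OGAProx_x : forall k,
    prox (fun u => (tau k)%:E * Phi u (y k.+1))%E (x k) (x k.+1)
}.

End SaddlePointProblem.

Section ErgodicAverage.
Context {R : realType}.

Definition weight_sum (theta : R) (K : nat) : R := \sum_(k < K) theta ^- k.

Definition ergodic {H : hilbertType R} (theta : R) (z : nat -> H) (K : nat) : H :=
  (weight_sum theta K)^-1 *: \sum_(k < K) theta ^- k *: z k.+1.

End ErgodicAverage.

(* Main.v *)
(* Strong convexity turns each prox step into a three-point inequality whose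
   quadratic term carries a factor 1 + tau * mu = 1 + sigma * nu = theta^-1.
   Adding the two of them to the gradient inequality for the concave function
   Phi x_(k+1), with q_k the extrapolated gradient, leaves the inner product of
   grad_(k+1) - q_k and ys - y_(k+1).  With d_k := grad_k - grad_(k-1) it is
   <d_(k+1), ys - y_(k+1)> - theta <d_k, ys - y_k> + theta <d_k, y_(k+1) - y_k>:
   the first two terms telescope under the weights theta^-k, the third one is
   absorbed by the quadratic terms through Cauchy-Schwarz and Young, which is
   what the lower bound on theta allows.  Jensen's inequality passes from the
   weighted sum of the gaps to the gap at the ergodic averages, and
   theta^K T_K >= theta. *)
Require Import Defs.
From mathcomp Require Import all_boot all_order all_algebra.
From mathcomp Require Import all_classical all_reals all_analysis.
From mathcomp Require Import ring lra.

Set Implicit Arguments.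
Unset Strict Implicit.
Unset Printing Implicit Defensive.

Import Order.TTheory GRing.Theory Num.Theory.
Import numFieldNormedType.Exports.

Local Open Scope classical_set_scope.
Local Open Scope ring_scope.

(** * Inner product identities and the Cauchy-Schwarz inequality *)

Section InnerProduct.
Context {R : realType} {H : hilbertType R}.
Implicit Types (u v w : H) (a t : R).

Lemma innerDl u v w : inner (u + v) w = inner u w + inner v w.
Proof. by rewrite -[u in LHS]scale1r inner_linearl mul1r. Qed.

Lemma inner0l w : inner 0 w = 0.
Proof. by have := innerDl 0 0 w; rewrite addr0; lra. Qed.

Lemma innerZl a u w : inner (a *: u) w = a * inner u w.
Proof. by rewrite -[a *: u]addr0 inner_linearl inner0l addr0. Qed.

Lemma innerNl u w : inner (- u) w = - inner u w.
Proof. by rewrite -scaleN1r innerZl mulN1r. Qed.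

Lemma innerDr u v w : inner w (u + v) = inner w u + inner w v.
Proof. by rewrite innerC innerDl !(innerC w). Qed.

Lemma innerZr a u w : inner w (a *: u) = a * inner w u.
Proof. by rewrite innerC innerZl innerC. Qed.

Lemma innerNr u w : inner w (- u) = - inner w u.
Proof. by rewrite innerC innerNl innerC. Qed.

Definition innerE := (innerDl, innerDr, innerZl, innerZr, innerNl, innerNr).

(* Squaring the triangle inequality gives Cauchy-Schwarz. *)
Lemma inner_le u v : inner u v <= `|u| * `|v|.
Proof.
have : `|u + v| ^+ 2 <= (`|u| + `|v|) ^+ 2 by rewrite lerXn2r ?nnegrE ?ler_normD.
rewrite sqrrD 3!sqr_norm_inner !innerE (innerC v u); lra.
Qed.

(** Being an equality, it converts convexity of [f - mu/2 |.|^2] into a bound with the exact gain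
    [t (1 - t) mu/2]. *)
Lemma sqr_norm_convex u v t :
  `|t *: u + (1 - t) *: v| ^+ 2
  = t * `|u| ^+ 2 + (1 - t) * `|v| ^+ 2 - t * (1 - t) * `|u - v| ^+ 2.
Proof. by rewrite !sqr_norm_inner !innerE (innerC v u); ring. Qed.

End InnerProduct.

(** * Strong convexity, three-point and gradient inequalities *)

Section StrongConvexity.
Context {R : realType} {H : hilbertType R}.
Implicit Types (f : H -> \bar R) (D : set H) (F : H -> R) (mu a t : R).

(** A real-valued form, so that the estimates avoid [\bar R]. Convexity of [D] is bundled in;
    [mu = 0] is plain convexity, and concavity is expressed through [- F]. *)
Definition strongly_convex_on D mu F := forall (x y : H) t, D x -> D y -> 0 <= t <= 1 ->
  D (t *: x + (1 - t) *: y) /\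
  F (t *: x + (1 - t) *: y)
  <= t * F x + (1 - t) * F y - mu / 2 * (t * (1 - t)) * `|x - y| ^+ 2.

Lemma edom_fin_num f (x : H) : (forall z, (-oo < f z)%E) -> edom f x -> f x \is a fin_num.
Proof. by move=> fNy fx; rewrite fin_real// fNy. Qed.

Lemma fineK_edom f (x : H) : (forall z, (-oo < f z)%E) -> edom f x -> (fine (f x))%:E = f x.
Proof. by move=> fNy fx; rewrite fineK// edom_fin_num. Qed.

Lemma strongly_convex_onP mu f : (forall x, (-oo < f x)%E) ->
  strongly_convex mu f -> strongly_convex_on (edom f) mu (fine \o f).
Proof.
move=> fNy fcvx x y t Dx Dy t01; have := fcvx x y t t01.
rewrite -(fineK_edom fNy Dx) -(fineK_edom fNy Dy) -!EFinB -!EFinM -EFinD.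
set z := t *: x + _ => fz.
(* The right-hand side of [fz] is finite, which rules out [f z = +oo]. *)
have Dz : edom f z by move: fz; rewrite /edom/=; case: (f z) => //= r; rewrite ltry.
split => //; move: fz; rewrite -(fineK_edom fNy Dz) -EFinB lee_fin sqr_norm_convex /=.
lra.
Qed.

Lemma econvexP f : econvex f -> strongly_convex 0 f.
Proof.
by move=> fcvx x y t t01; rewrite !mul0r !sube0; apply: fcvx.
Qed.

Lemma strongly_convex_on_weaken D mu F mu' : mu' <= mu ->
  strongly_convex_on D mu F -> strongly_convex_on D mu' F.
Proof.
move=> mu_le Fcvx x y t Dx Dy t01; have [Dz Fz] := Fcvx x y t Dx Dy t01; split => //.
apply: (le_trans Fz); rewrite lerD2l lerN2 -!mulrA ler_wpM2r ?ler_pM2r//.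
by case/andP: t01 => t0 t1; rewrite !mulr_ge0 ?subr_ge0.
Qed.

(** Replaces a passage to the limit: if [a > 0], then [t = 1] gives [a <= b], so [t = a / 2 / b] is
    admissible and yields [a <= a / 2]. *)
Lemma le0_of_le_mul a b : (forall t, 0 < t <= 1 -> a <= t * b) -> a <= 0.
Proof.
move=> ab; rewrite leNgt; apply/negP => a0.
have ble : a <= b by have := ab 1; rewrite ltr01 lexx mul1r; apply.
have b0 : 0 < b by exact: lt_le_trans ble.
have := ab (a / 2 / b); rewrite !divr_gt0// ler_pdivrMr// mul1r divfK ?gt_eqF//=.
by move=> /(_ _); lra.
Qed.

(* Compare p with t u + (1 - t) p, divide by t and let t go to 0. *)
Lemma prox_three_points D mu F s (z p : H) : 0 <= s -> strongly_convex_on D mu F ->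
  D p -> (forall u, D u ->
    s * F p + 2^-1 * `|p - z| ^+ 2 <= s * F u + 2^-1 * `|u - z| ^+ 2) ->
  forall u, D u -> s * F p + 2^-1 * `|p - z| ^+ 2 + 2^-1 * (s * mu + 1) * `|u - p| ^+ 2
    <= s * F u + 2^-1 * `|u - z| ^+ 2.
Proof.
move=> s0 Fcvx Dp pmin u Du; rewrite -subr_le0.
apply: (@le0_of_le_mul _ (2^-1 * (s * mu + 1) * `|u - p| ^+ 2)) => t /andP[t0 t1].
have t01 : 0 <= t <= 1 by rewrite (ltW t0) t1.
have [Dv Fv] := Fcvx u p t Du Dp t01.
have := pmin _ Dv.
have -> : t *: u + (1 - t) *: p - z = t *: (u - z) + (1 - t) *: (p - z).
  by rewrite !scalerBr [in RHS]addrACA -opprD -scalerDl [t + _]addrC subrK scale1r.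
rewrite sqr_norm_convex; have -> : u - z - (p - z) = u - p by rewrite opprB addrA subrK.
move: Fv => /(ler_wpM2l s0) Fv pv.
rewrite -(ler_pM2l t0); nra.
Qed.

(** The inner product is a directional derivative, hence a limit from the right of difference
    quotients; by concavity each quotient with step in (0, 1] is at least [F z - F x]. *)
Lemma concave_gradient_le F (x v z : H) :
  strongly_convex_on setT 0 (fun u => - F u) -> is_gradient F x v ->
  F z - F x <= inner v (z - x).
Proof.
move=> Fccv [dF dFE]; rewrite -dFE -deriveE//.
have dvb := diff_derivable (v := z - x) dF.
rewrite /derive cvg_at_rightE//; apply: limr_ge.
  (* The right limit exists because right neighbourhoods of 0 refine the punctured ones. *)
  rewrite -(cvg_at_rightE (fun h : R => h^-1 *: ((F \o shift x) (h *: (z - x)) - F x)))//.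
  apply: cvg_trans dvb; apply: cvg_app => A [e e0 Ae]; exists e => // h he h0.
  by apply: Ae => //; exact/lt0r_neq0.
near=> h.
have h0 : 0 < h by near: h; exact: nbhs_right_gt.
have h1 : h <= 1 by near: h; exact: nbhs_right_le.
have h01 : 0 <= h <= 1 by rewrite (ltW h0).
have [_] := Fccv z x h I I h01; rewrite !mul0r subr0.
have -> : h *: z + (1 - h) *: x = h *: (z - x) + x.
  by rewrite scalerBl scalerBr scale1r addrCA addrC.
rewrite /= => Fh.
rewrite -(ler_pM2l h0) mulrA mulfV ?gt_eqF// mul1r; lra.
Unshelve. all: by end_near.
Qed.

End StrongConvexity.

(** * Weighted averages and Jensen's inequality *)

Section ErgodicJensen.
Context {R : realType} {H : hilbertType R}.
Implicit Types (D : set H) (F : H -> R) (theta : R) (z : nat -> H) (K : nat).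

Lemma weight_sumS theta K : weight_sum theta K.+1 = weight_sum theta K + theta ^- K.
Proof. by rewrite /weight_sum big_ord_recr. Qed.

Lemma weight_sum_ge0 theta K : 0 < theta -> 0 <= weight_sum theta K.
Proof.
by move=> theta0; apply: sumr_ge0 => i _; rewrite invr_ge0 exprn_ge0 ?ltW.
Qed.

Lemma weight_sum_gt0 theta K : 0 < theta -> (0 < K)%N -> 0 < weight_sum theta K.
Proof.
move=> theta0; case: K => // K _.
by rewrite weight_sumS ltr_wpDl ?weight_sum_ge0 ?invr_gt0 ?exprn_gt0.
Qed.

(** Writing each average as a two-point convex combination lets Jensen's inequality follow by
    induction. *)
Lemma ergodicS theta z K : 0 < theta -> (0 < K)%N ->
  let t := theta ^- K / weight_sum theta K.+1 in
  ergodic theta z K.+1 = t *: z K.+1 + (1 - t) *: ergodic theta z K.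
Proof.
move=> theta0 K0 t; have T0 := weight_sum_gt0 theta0 K0.
have TS0 : 0 < weight_sum theta K.+1 by exact: weight_sum_gt0.
have -> : 1 - t = (weight_sum theta K.+1)^-1 * weight_sum theta K.
  have -> : weight_sum theta K = weight_sum theta K.+1 - theta ^- K.
    by rewrite weight_sumS addrK.
  by rewrite mulrBr mulVf ?gt_eqF// [_ * theta ^- K]mulrC.
rewrite [LHS]/ergodic big_ord_recr /=.
have -> : \sum_(k < K) theta ^- k *: z k.+1 = weight_sum theta K *: ergodic theta z K.
  by rewrite /ergodic scalerA mulfV ?gt_eqF// scale1r.
by rewrite scalerDr !scalerA addrC [_ * theta ^- K]mulrC.
Qed.

Lemma ergodic_jensen D F theta z K : 0 < theta -> strongly_convex_on D 0 F ->
  (forall k, D (z k.+1)) -> (0 < K)%N ->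
  D (ergodic theta z K) /\
  weight_sum theta K * F (ergodic theta z K) <= \sum_(k < K) theta ^- k * F (z k.+1).
Proof.
(* The induction starts at [K = 1]: the empty average is 0, which may lie outside [D]. *)
move=> theta0 Fcvx Dz; elim: K => // -[_ _|K /(_ isT)[De Fe] _].
  rewrite /ergodic /weight_sum !big_ord1 expr0 !invr1 !scale1r !mul1r.
  by split; first exact: Dz.
set t := theta ^- K.+1 / weight_sum theta K.+2.
have T0 : 0 < weight_sum theta K.+1 by exact: weight_sum_gt0.
have TS0 : 0 < weight_sum theta K.+2 by exact: weight_sum_gt0.
have w0 : 0 < theta ^- K.+1 by rewrite invr_gt0 exprn_gt0.
have tT : weight_sum theta K.+2 * t = theta ^- K.+1 by rewrite mulrC divfK ?gt_eqF.
have t01 : 0 <= t <= 1.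
  apply/andP; split; first by rewrite divr_ge0 ?ltW.
  by rewrite ler_pdivrMr// mul1r [weight_sum theta K.+2]weight_sumS lerDr ltW.
have [Dz' Fz] := Fcvx _ _ _ (Dz K.+1) De t01.
rewrite (ergodicS z theta0 (ltn0Sn K)); split => //.
move: Fz => /(ler_wpM2l (ltW TS0)) Fz; apply: (le_trans Fz).
rewrite big_ord_recr /= !mul0r subr0 mulrDr mulrA tT mulrA mulrBr tT mulr1.
rewrite [weight_sum theta K.+2]weight_sumS addrK.
by rewrite [leLHS]addrC lerD2r.
Qed.

End ErgodicJensen.

(** * Prox steps of extended-valued functions *)

Section Prox.
Context {R : realType} {H : hilbertType R}.
Implicit Types (f : H -> \bar R).

Lemma prox_strongly_convex f (mu s : R) (z p : H) : 0 < s -> eproper f ->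
  strongly_convex mu f -> prox (fun u => s%:E * f u)%E z p ->
  edom f p /\ forall u, edom f u ->
    s * fine (f p) + 2^-1 * `|p - z| ^+ 2 + 2^-1 * (s * mu + 1) * `|u - p| ^+ 2
    <= s * fine (f u) + 2^-1 * `|u - z| ^+ 2.
Proof.
move=> s0 [fNy [u0 Du0]] fcvx pmin.
(* The objective is finite at [u0], whereas [f p = +oo] would make its minimum infinite since
   [s > 0]. *)
have Dp : edom f p.
  have := pmin u0; rewrite -(fineK_edom fNy Du0) -EFinM -EFinD /edom /=.
  by case: (f p) => [r||] //; rewrite ?ltry// gt0_muley ?lte_fin//= addye.
split => //; apply: (prox_three_points (F := fine \o f) (ltW s0) _ Dp).
  exact: strongly_convex_onP.
move=> u Du; have := pmin u.
by rewrite -(fineK_edom fNy Du) -(fineK_edom fNy Dp) -!EFinM -!EFinD lee_fin.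
Qed.

End Prox.

(** * Domains and finite values of the saddle function *)

Section Setting.
Context {R : realType} {H G : hilbertType R}.
Context {Phi : H -> G -> \bar R} {g : G -> \bar R} {gradPhi : H -> G -> G}.
Context {nu Lyx Lyy : R}.
Hypothesis Hset : standing_assumptions Phi g gradPhi nu Lyx Lyy.

(** By [Phi_fin], a point where [Phi u] is finite once is one where it is finite everywhere; all
    primal prox steps thus share one domain. *)
Lemma Phi_edom y : edom g y -> edom (Phi ^~ y) = projdom Phi.
Proof.
move=> gy; apply/seteqP; split => u /=; first by exists y.
by move=> /(Phi_fin Hset) Pu; have : edom (Phi u) y by rewrite Pu.
Qed.

Lemma PhiK u y : projdom Phi u -> (fine (Phi u y))%:E = Phi u y.
Proof.
move=> Pu; apply: (fineK_edom (Phi_gtNy Hset u)).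
by rewrite (Phi_fin Hset Pu).
Qed.

Lemma PsiE u y : projdom Phi u -> edom g y ->
  Psi Phi g u y = (fine (Phi u y) - fine (g y))%:E.
Proof.
move=> Pu gy; by rewrite /Psi -PhiK// -(fineK_edom (proj1 (g_proper Hset)) gy).
Qed.

Lemma Psi_projdomC u y : ~ projdom Phi u -> Psi Phi g u y = +oo%E.
Proof.
(* Dual addition returns [+oo] even when [g y = +oo]. *)
move=> Pu; rewrite /Psi; have -> : Phi u y = +oo%E; last by case: (g y).
by apply/eqP; rewrite -leye_eq leNgt; apply/negP => Puy; apply: Pu; exists y.
Qed.

Lemma Psi_edomC u y : projdom Phi u -> ~ edom g y -> Psi Phi g u y = -oo%E.
Proof.
move=> Pu gy; rewrite /Psi -PhiK//; have -> // : g y = +oo%E.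
by apply/eqP; rewrite -leye_eq leNgt; apply/negP.
Qed.

(** An infinite saddle value is refuted by comparison: [+oo] with the value at [u0], then [-oo] with
    the finite value at [y0]. *)
Lemma saddle_point_dom xs ys : saddle_point Phi g xs ys ->
  projdom Phi xs /\ edom g ys.
Proof.
move=> sp; have [u0 Pu0] := Phi_dom Hset; have [_ [y0 gy0]] := g_proper Hset.
have [sp1 sp2] := sp u0 y0.
have Pxs : projdom Phi xs.
  apply: contrapT => Pxs; move: sp2; rewrite (Psi_projdomC _ Pxs).
  have [gys|gys] := pselect (edom g ys); first by rewrite PsiE.
  by rewrite Psi_edomC.
split => //; apply: contrapT => gys; move: sp1.
by rewrite (Psi_edomC Pxs gys) PsiE.
Qed.

Lemma g_convex_on : strongly_convex_on (edom g) 0 (fine \o g).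
Proof.
apply: (strongly_convex_on_weaken (nu_ge0 Hset)).
exact: strongly_convex_onP (proj1 (g_proper Hset)) (g_convex Hset).
Qed.

Lemma Phi_convex_on y : edom g y ->
  strongly_convex_on (projdom Phi) 0 (fun u => fine (Phi u y)).
Proof.
move=> gy; rewrite -(Phi_edom gy).
apply: (@strongly_convex_onP _ _ 0 (Phi ^~ y)) => [u|]; first exact: Phi_gtNy Hset _ _.
exact/econvexP/(Phi_convex Hset).
Qed.

Lemma Phi_concave_on u : projdom Phi u ->
  strongly_convex_on setT 0 (fun y => - fine (Phi u y)).
Proof.
move=> Pu.
have NPhiE : (fun y => - Phi u y)%E = (fun y => (- fine (Phi u y))%:E).
  by apply/funext => y; rewrite -PhiK.
have := Phi_concave Hset Pu; rewrite /econcave NPhiE => /econvexP.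
move=> /strongly_convex_onP-/(_ (fun=> ltNyr _)).
by have -> : edom (fun y => (- fine (Phi u y))%:E) = setT by
  apply/seteqP; split => y //= _; exact: ltry.
Qed.

End Setting.

(** * One-step descent and its telescoped sum *)

Section Convergence.
Context {R : realType} {H G : hilbertType R}.
Context {Phi : H -> G -> \bar R} {g : G -> \bar R} {gradPhi : H -> G -> G}.
Context {nu mu Lyx Lyy : R}.
Hypothesis Hset : standing_assumptions Phi g gradPhi nu Lyx Lyy.
Hypothesis Phi_strong : forall y, edom g y -> strongly_convex mu (Phi ^~ y).
Context {theta tau sigma : R} {x : nat -> H} {y : nat -> G}.
Hypothesis Halg : OGAProx Phi g gradPhi (fun=> sigma) (fun=> tau) (fun=> theta) x y.
Hypotheses (tau_gt0 : 0 < tau) (sigma_gt0 : 0 < sigma).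

Lemma OGAProx_edom k : edom g (y k).
Proof.
case: k => [|k]; first exact: OGAProx_y0 Halg.
by have [] := prox_strongly_convex sigma_gt0 (g_proper Hset) (g_convex Hset)
  (OGAProx_y Halg k).
Qed.

Lemma OGAProx_projdom k : projdom Phi (x k).
Proof.
case: k => [|k]; first exact: OGAProx_x0 Halg.
have gy := OGAProx_edom k.+1; rewrite -(Phi_edom Hset gy).
by have [] := prox_strongly_convex tau_gt0 (Phi_proper Hset gy) (Phi_strong gy)
  (OGAProx_x Halg k).
Qed.

Let grad k := gradPhi (x k) (y k).
(** Vanishes at [k = 0] because [0.-1 = 0], so the first step has no extrapolation. *)
Let dgrad k := grad k - grad k.-1.

Lemma OGAProx_dual_step k v : edom g v ->
  fine (g (y k.+1)) - fine (g v)
  <= (2 * sigma)^-1 * (`|v - y k| ^+ 2 - `|y k.+1 - y k| ^+ 2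
                       - (sigma * nu + 1) * `|v - y k.+1| ^+ 2)
     - inner (grad k + theta *: dgrad k) (v - y k.+1).
Proof.
move=> gv; have [_ /(_ v gv)] := prox_strongly_convex sigma_gt0 (g_proper Hset)
  (g_convex Hset) (OGAProx_y Halg k).
have -> : (1 + theta) *: gradPhi (x k) (y k) - theta *: gradPhi (x k.-1) (y k.-1)
    = grad k + theta *: dgrad k.
  by rewrite /dgrad /grad scalerBr scalerDl scale1r addrA.
move: (grad k + _) => q; rewrite !opprD !addrA.
(* The terms in [|q|^2] cancel between the two sides; only the linear ones survive. *)
have sqrB u : `|u - y k - sigma *: q| ^+ 2
    = `|u - y k| ^+ 2 - 2 * sigma * inner q (u - y k) + sigma ^+ 2 * `|q| ^+ 2.
  by rewrite !sqr_norm_inner !innerE !(innerC _ q); ring.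
rewrite !sqrB => le3; rewrite -(ler_pM2l sigma_gt0).
have -> : inner q (v - y k.+1) = inner q (v - y k) - inner q (y k.+1 - y k).
  by rewrite !innerE; ring.
rewrite mulrBr [leRHS]mulrBr [sigma * (_ * _)]mulrA.
have -> : sigma * (2 * sigma)^-1 = 2^-1 by field; exact: lt0r_neq0.
move: le3; lra.
Qed.

Lemma OGAProx_primal_step k u : projdom Phi u ->
  fine (Phi (x k.+1) (y k.+1)) - fine (Phi u (y k.+1))
  <= (2 * tau)^-1 * (`|u - x k| ^+ 2 - `|x k.+1 - x k| ^+ 2
                     - (tau * mu + 1) * `|u - x k.+1| ^+ 2).
Proof.
have gy := OGAProx_edom k.+1; rewrite -(Phi_edom Hset gy) => Du.
have [_ /(_ u Du) le3] := prox_strongly_convex tau_gt0 (Phi_proper Hset gy)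
  (Phi_strong gy) (OGAProx_x Halg k).
rewrite -(ler_pM2l tau_gt0) [leRHS]mulrA.
have -> : tau * (2 * tau)^-1 = 2^-1 by field; exact: lt0r_neq0.
move: le3; lra.
Qed.

Context {alpha : R} {xs : H} {ys : G}.
Hypotheses (alpha_gt0 : 0 < alpha) (Pxs : projdom Phi xs) (gys : edom g ys).

(** Cauchy-Schwarz and the Lipschitz bound, then Young's inequality with weight [alpha] on the
    primal part and weight 1 on the dual part. *)
Lemma inner_dgrad_le k (w : G) :
  inner (dgrad k) w <= Lyx / (2 * alpha) * `|x k - x k.-1| ^+ 2
    + Lyy / 2 * `|y k - y k.-1| ^+ 2 + (alpha * Lyx + Lyy) / 2 * `|w| ^+ 2.
Proof.
apply: (le_trans (inner_le _ _)).
have := grad_lipschitz Hset (OGAProx_projdom k) (OGAProx_projdom k.-1)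
  (OGAProx_edom k) (OGAProx_edom k.-1).
move=> /(ler_wpM2r (normr_ge0 w)) lip; apply: (le_trans lip).
set a := `|x k - _|; set b := `|y k - _|; set c := `|w|.
have Lyx0 := Lyx_ge0 Hset; have Lyy0 := Lyy_ge0 Hset.
have xle : Lyx * (a * c) <= Lyx * (a ^+ 2 / (2 * alpha) + alpha / 2 * c ^+ 2).
  apply: ler_wpM2l => //; rewrite -subr_ge0.
  have -> : a ^+ 2 / (2 * alpha) + alpha / 2 * c ^+ 2 - a * c
      = (a - alpha * c) ^+ 2 / (2 * alpha) by field; exact: lt0r_neq0.
  by rewrite divr_ge0 ?sqr_ge0// mulr_ge0// ltW.
have yle : Lyy * (b * c) <= Lyy * (b ^+ 2 / 2 + c ^+ 2 / 2).
  by apply: ler_wpM2l => //; have := sqr_ge0 (b - c); lra.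
move: xle yle; lra.
Qed.

Hypotheses (theta_gt0 : 0 < theta).
Hypotheses (tau_mu : tau * mu + 1 = theta^-1) (sigma_nu : sigma * nu + 1 = theta^-1).
Hypothesis tau_le : Lyx / (2 * alpha) <= (2 * tau)^-1.
Hypothesis sigma_le : theta * (alpha * Lyx + Lyy) / 2 + Lyy / 2 <= (2 * sigma)^-1.

(** The real value of [Psi (x k.+1) ys - Psi xs (y k.+1)]. *)
Let gap k := fine (Phi (x k.+1) ys) - fine (g ys)
             - (fine (Phi xs (y k.+1)) - fine (g (y k.+1))).

(* Not a priori nonnegative because of the inner product; see lyapunov_ge. *)
Let lyapunov k := (2 * tau)^-1 * `|xs - x k| ^+ 2 + (2 * sigma)^-1 * `|ys - y k| ^+ 2
  + theta * (Lyx / (2 * alpha) * `|x k - x k.-1| ^+ 2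
             + Lyy / 2 * `|y k - y k.-1| ^+ 2 - inner (dgrad k) (ys - y k)).

Lemma OGAProx_descent k : gap k + theta^-1 * lyapunov k.+1 <= lyapunov k.
Proof.
have ystep := OGAProx_dual_step k gys.
have xstep := OGAProx_primal_step k Pxs.
have Pxk := OGAProx_projdom k.+1.
have grad_le := concave_gradient_le ys (Phi_concave_on Hset Pxk)
  (Phi_grad Hset (y k.+1) Pxk).
have lip := inner_dgrad_le k (y k.+1 - y k).
have gradE : inner (grad k.+1) (ys - y k.+1) - inner (grad k + theta *: dgrad k) (ys - y k.+1)
    = inner (dgrad k.+1) (ys - y k.+1) - theta * inner (dgrad k) (ys - y k)
      + theta * inner (dgrad k) (y k.+1 - y k).
  by rewrite /dgrad /= !innerE; ring.
(* The squared primal increment left by the prox step pays for the one stored in [lyapunov k.+1]. *)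
have xcoef : 0 <= ((2 * tau)^-1 - Lyx / (2 * alpha)) * `|x k.+1 - x k| ^+ 2.
  by rewrite mulr_ge0 ?sqr_ge0// subr_ge0.
(* The dual increment pays for the stored [Lyy / 2] and for the Young term of [lip]. *)
have ycoef : 0 <= ((2 * sigma)^-1 - (theta * (alpha * Lyx + Lyy) / 2 + Lyy / 2))
    * `|y k.+1 - y k| ^+ 2.
  by rewrite mulr_ge0 ?sqr_ge0// subr_ge0.
have thetaV : theta^-1 * lyapunov k.+1
  = (2 * tau)^-1 * theta^-1 * `|xs - x k.+1| ^+ 2
    + (2 * sigma)^-1 * theta^-1 * `|ys - y k.+1| ^+ 2
    + (Lyx / (2 * alpha) * `|x k.+1 - x k| ^+ 2
       + Lyy / 2 * `|y k.+1 - y k| ^+ 2 - inner (dgrad k.+1) (ys - y k.+1)).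
  rewrite /lyapunov [LHS]mulrDr mulKf ?gt_eqF//=; lra.
rewrite thetaV /gap /lyapunov.
move: ystep xstep grad_le gradE xcoef ycoef (ler_wpM2l (ltW theta_gt0) lip).
rewrite tau_mu sigma_nu /grad.
set A := (2 * tau)^-1; set B := (2 * sigma)^-1; set C := Lyx / (2 * alpha).
lra.
Qed.

(** The factor [theta^-1] in the descent is the ratio of consecutive weights, so the weighted sum
    telescopes. *)
Lemma OGAProx_sum_gap K :
  \sum_(k < K) theta ^- k * gap k + theta ^- K * lyapunov K <= lyapunov 0.
Proof.
elim: K => [|K IH]; first by rewrite big_ord0 expr0 invr1 mul1r add0r.
apply: le_trans IH; rewrite big_ord_recr /= -addrA lerD2l.
rewrite exprS invfM [_^-1 * _^-1]mulrC -mulrA -mulrDr ler_pM2l ?invr_gt0 ?exprn_gt0//.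
exact: OGAProx_descent.
Qed.

(** Bounding the inner product with [w = ys - y K] cancels exactly the stored increments. *)
Lemma lyapunov_ge K :
  (2 * tau)^-1 * `|xs - x K| ^+ 2
  + ((2 * sigma)^-1 - theta * (alpha * Lyx + Lyy) / 2) * `|ys - y K| ^+ 2
  <= lyapunov K.
Proof.
have := ler_wpM2l (ltW theta_gt0) (inner_dgrad_le K (ys - y K)).
rewrite /lyapunov; lra.
Qed.

Lemma lyapunov0 : lyapunov 0
  = (2 * tau)^-1 * `|xs - x 0%N| ^+ 2 + (2 * sigma)^-1 * `|ys - y 0%N| ^+ 2.
Proof.
by rewrite /lyapunov /dgrad /= !subrr !normr0 !expr0n/= inner0l; ring.
Qed.

(** Jensen is applied to [Phi ^~ ys], [g] and [- Phi xs]; the memberships make [Psi] real at the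
    averages. *)
Lemma ergodic_gap_le K : (0 < K)%N ->
  projdom Phi (ergodic theta x K) /\ edom g (ergodic theta y K) /\
  weight_sum theta K *
    (fine (Phi (ergodic theta x K) ys) - fine (g ys)
     - (fine (Phi xs (ergodic theta y K)) - fine (g (ergodic theta y K))))
  <= \sum_(k < K) theta ^- k * gap k.
Proof.
move=> K0.
have [Px xjensen] := ergodic_jensen theta_gt0 (Phi_convex_on Hset gys)
  (fun k => OGAProx_projdom k.+1) K0.
have [gy gjensen] := ergodic_jensen theta_gt0 (g_convex_on Hset)
  (fun k => OGAProx_edom k.+1) K0.
have [_ yjensen] := ergodic_jensen theta_gt0 (Phi_concave_on Hset Pxs)
  (fun k => I : setT (y k.+1)) K0.
split => //; split => //.
have -> : \sum_(k < K) theta ^- k * gap k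
    = \sum_(k < K) theta ^- k * fine (Phi (x k.+1) ys)
      + \sum_(k < K) theta ^- k * (fine \o g) (y k.+1)
      + \sum_(k < K) theta ^- k * - fine (Phi xs (y k.+1))
      - weight_sum theta K * fine (g ys).
  rewrite /weight_sum mulr_suml -!big_split -sumrB; apply: eq_bigr => k _ /=.
  by rewrite /gap; ring.
move: xjensen gjensen yjensen => /=; lra.
Qed.

End Convergence.

(** * Step sizes and the final estimate *)

Theorem theorem13 (R : realType) (H G : hilbertType R)
  (Phi : H -> G -> \bar R) (g : G -> \bar R) (gradPhi : H -> G -> G)
  (nu mu Lyx Lyy : R)
  (Hset : standing_assumptions Phi g gradPhi nu Lyx Lyy)
  (nu_gt0 : 0 < nu) (mu_gt0 : 0 < mu)
  (Phi_strong : forall y, edom g y -> strongly_convex mu (Phi ^~ y))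
  (xs : H) (ys : G) (Hsaddle : saddle_point Phi g xs ys)
  (alpha thetat theta tau sigma : R)
  (alpha_gt0 : 0 < alpha)
  (thetatE : thetat =
    Num.max (Lyx / (alpha * mu + Lyx))
            ((alpha * Lyx + 2 * Lyy) / (nu + alpha * Lyx + 2 * Lyy)))
  (thetat_ge0 : 0 <= thetat) (thetat_lt : thetat < theta) (theta_lt1 : theta < 1)
  (tauE : tau = mu^-1 * ((1 - theta) / theta))
  (sigmaE : sigma = nu^-1 * ((1 - theta) / theta))
  (x : nat -> H) (y : nat -> G)
  (Halg : OGAProx Phi g gradPhi (fun=> sigma) (fun=> tau) (fun=> theta) x y) :
  let sigmat := sigma / (1 - theta * sigma * (alpha * Lyx + Lyy)) in
  forall K : nat, (1 <= K)%N ->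
  (0 <= theta%:E * (Psi Phi g (ergodic theta x K) ys
                    - Psi Phi g xs (ergodic theta y K))
        + ((2 * tau)^-1 * `|xs - x K| ^+ 2
           + (2 * sigmat)^-1 * `|ys - y K| ^+ 2)%:E
     <= (theta ^+ K * ((2 * tau)^-1 * `|xs - x 0%N| ^+ 2
                       + (2 * sigma)^-1 * `|ys - y 0%N| ^+ 2))%:E)%E.
Proof.
move=> sigmat K K0.
have theta_gt0 : 0 < theta by exact: le_lt_trans thetat_lt.
have r_gt0 : 0 < (1 - theta) / theta by rewrite divr_gt0// subr_gt0.
have tau_gt0 : 0 < tau by rewrite tauE mulr_gt0// invr_gt0.
have sigma_gt0 : 0 < sigma by rewrite sigmaE mulr_gt0// invr_gt0.
have Lyx0 := Lyx_ge0 Hset; have Lyy0 := Lyy_ge0 Hset.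
have aL0 : 0 <= alpha * Lyx by rewrite mulr_ge0// ltW.
have tau_mu : tau * mu + 1 = theta^-1.
  by rewrite tauE; field; rewrite !lt0r_neq0.
have sigma_nu : sigma * nu + 1 = theta^-1.
  by rewrite sigmaE; field; rewrite !lt0r_neq0.
(* The first argument of the maximum controls [tau], the second [sigma]. *)
move: thetat_lt; rewrite thetatE gt_max => /andP[].
rewrite ltr_pdivrMr ?ltr_wpDr ?mulr_gt0// => theta_x.
rewrite ltr_pdivrMr => [theta_y|]; last lra.
have [Pxs gys] := saddle_point_dom Hset Hsaddle.
have onem_gt0 : 0 < 1 - theta by rewrite subr_gt0.
have tau_le : Lyx / (2 * alpha) <= (2 * tau)^-1.
  have -> : (2 * tau)^-1 = mu * theta / (2 * (1 - theta)).
    by rewrite tauE; field; rewrite !lt0r_neq0.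
  rewrite ler_pdivrMr ?mulr_gt0// mulrAC ler_pdivlMr ?mulr_gt0//.
  move: theta_x; lra.
have sigma_le : theta * (alpha * Lyx + Lyy) / 2 + Lyy / 2 <= (2 * sigma)^-1.
  have -> : (2 * sigma)^-1 = nu * theta / (2 * (1 - theta)).
    by rewrite sigmaE; field; rewrite !lt0r_neq0.
  rewrite ler_pdivlMr ?mulr_gt0//.
  (* [theta_y] gives the bound with [alpha Lyx + 2 Lyy], which exceeds
     [theta (alpha Lyx + Lyy) + Lyy] by [(1 - theta) (alpha Lyx + Lyy)]. *)
  have := mulr_ge0 (ltW onem_gt0) (addr_ge0 aL0 Lyy0) => aLL.
  have := mulr_ge0 (ltW onem_gt0) aLL.
  move: theta_y; lra.
(* This is the dual coefficient in [lyapunov_ge]; its sign follows from [sigma_le]. *)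
have sigmatE : (2 * sigmat)^-1 = (2 * sigma)^-1 - theta * (alpha * Lyx + Lyy) / 2.
  rewrite /sigmat invfM invf_div; field; exact: lt0r_neq0.
have sigmat_ge0 : 0 <= (2 * sigmat)^-1 by rewrite sigmatE; lra.
have [Px [gy ergodic_le]] :=
  ergodic_gap_le Hset Phi_strong Halg tau_gt0 sigma_gt0 Pxs gys theta_gt0 K0.
have sum_le := OGAProx_sum_gap Hset Phi_strong Halg tau_gt0 sigma_gt0 alpha_gt0
  Pxs gys theta_gt0 tau_mu sigma_nu tau_le sigma_le K.
have lyap_ge := lyapunov_ge Hset Phi_strong Halg tau_gt0 sigma_gt0 alpha_gt0
  (xs := xs) (ys := ys) theta_gt0 K.
rewrite lyapunov0 in sum_le.
rewrite -sigmatE in lyap_ge.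
(* Both averages are compared with the saddle value [Psi xs ys]. *)
have gap_ge0 : 0 <= fine (Phi (ergodic theta x K) ys) - fine (g ys)
    - (fine (Phi xs (ergodic theta y K)) - fine (g (ergodic theta y K))).
  have [+ _] := Hsaddle xs (ergodic theta y K).
  have [_] := Hsaddle (ergodic theta x K) ys.
  rewrite !(PsiE Hset)// !lee_fin; lra.
rewrite !(PsiE Hset)// -EFinB -EFinM -EFinD !lee_fin; apply/andP; split.
  have tau2_ge0 : 0 <= (2 * tau)^-1 by rewrite invr_ge0 mulr_ge0// ltW.
  rewrite addr_ge0//; first exact: mulr_ge0 (ltW theta_gt0) gap_ge0.
  exact: addr_ge0 (mulr_ge0 tau2_ge0 (sqr_ge0 _)) (mulr_ge0 sigmat_ge0 (sqr_ge0 _)).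
have powK0 : 0 < theta ^+ K by rewrite exprn_gt0.
have theta_le : theta <= theta ^+ K * weight_sum theta K.
  (* The last summand of [weight_sum] alone contributes [theta]. *)
  case: K K0 {ergodic_le sum_le lyap_ge gap_ge0 Px gy powK0} => // K _.
  rewrite weight_sumS mulrDr [X in _ + X](_ : _ = theta) ?lerDr; last first.
    by rewrite exprS mulfK// expf_neq0// gt_eqF.
  by rewrite mulr_ge0 ?weight_sum_ge0// exprn_ge0 ?ltW.
(* Since the gap is nonnegative, [theta] may be raised to [theta^K T_K]; the common factor [theta^K]
   is then divided out. *)
apply: (le_trans (lerD (ler_wpM2r gap_ge0 theta_le) lyap_ge)).
rewrite -(ler_pM2l (_ : 0 < theta ^- K)) ?invr_gt0// mulrDr -[theta ^+ K * _ * _]mulrA.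
rewrite !mulKf ?gt_eqF//.
exact: le_trans (lerD ergodic_le (lexx _)) sum_le.
Qed.
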